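(* Let $\mathbf{G}$ be a finite MW-graph with combinatorial weights and let $\mathbf{G}'=\mathbf{G}-E_0$, also with combinatorial weights, be a spanning subgraph of $\mathbf{G}$. Then $\lambda_k(\mathbf{G}')\le\lambda_k(\mathbf{G})$ for all $k\in\{1,\dots,|V(\mathbf{G})|\}$.
   Context: Graphs: a graph $G=(V,E,\partial)$ consists of disjoint sets $V$ (vertices) and $E$ (edges), a map $\partial\colon E\to V\times V$, $\partial e=(\partial_-e,\partial_+e)$, and an involution $e\mapsto\bar e$ on $E$ with $e\neq\bar e$ and $\partial_\pm\bar e=\partial_\mp e$. Loops and multiple edges are allowed; $G$ need not be connected. $E_v=\{e\in E:\partial_-e=v\}$ is finite for each $v$. A magnetic potential is a map $\alpha\colon E\to R$ with $\alpha_{\bar e}=-\alpha_e$, where $R$ is a fixed subgroup of $\mathbb{R}/2\pi\mathbb{Z}$. An MW-graph with combinatorial weights is $\mathbf{G}=(G,\alpha,\mathbf{1})$ (all vertex and edge weights equal to $1$). A spanning subgraph $\mathbf{G}-E_0$ is obtained by deleting all edges of a set $E_0\subset E$ (closed under $e\mapsto\bar e$), keeping all vertices, and restricting $\alpha$ to $E\setminus E_0$. For finite $V$, $\lambda_1(\mathbf{G})\le\dots\le\lambda_{|V|}(\mathbf{G})$ are the eigenvalues, with multiplicity, of the magnetic combinatorial Laplacian $(\Delta_\alpha\varphi)(v)=\sum_{e\in E_v}\bigl(\varphi(v)-\mathrm{e}^{\mathrm{i}\alpha_e}\varphi(\partial_+e)\bigr)$, self-adjoint on $\ell_2(V)$.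 *)

(* Defs.v *)
From HB Require Import structures.
From mathcomp Require Import all_boot all_order all_algebra.
From mathcomp Require Import generic_quotient ring_quotient.
From mathcomp Require Import complex.
From mathcomp Require Import boolp reals trigo.

Set Implicit Arguments.
Unset Strict Implicit.
Unset Printing Implicit Defensive.

Import Order.TTheory GRing.Theory Num.Theory.
Local Open Scope ring_scope.
Local Open Scope complex_scope.
Local Open Scope quotient_scope.
Local Open Scope sesquilinear_scope.

Definition two_pi_int (K : realType) : {pred K} :=
  [pred x | `[< exists n : int, x = (pi *+ 2) *~ n >]].

Fact two_pi_int_zmod_closed (K : realType) : zmod_closed (@two_pi_int K).
Proof.
split=> [|x y]; rewrite !inE.
  by apply/asboolP; exists 0; rewrite mulr0z.
move=> /asboolP[m ->] /asboolP[n ->]; apply/asboolP.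
by exists (m - n); rewrite mulrzBr.
Qed.

HB.instance Definition _ (K : realType) :=
  GRing.isZmodClosed.Build K (@two_pi_int K) (@two_pi_int_zmod_closed K).

Notation angle K := (Quotient.quot (@two_pi_int K)).

(* The value e^{i a} is computed on a representative of the class a;
   expi_pi shows that it does not depend on the representative. *)
Definition expi (K : realType) (a : angle K) : K[i] :=
  cos (repr a) +i* sin (repr a).

Lemma expi_pi (K : realType) (x : K) :
  expi (\pi_(angle K) x) = cos x +i* sin x.
Proof.
have /asboolP[n En] : repr (\pi_(angle K) x) - x \in @two_pi_int K.
  by rewrite Quotient.idealrBE reprK.
have -> : expi (\pi_(angle K) x) = cos (x + (pi *+ 2) *~ n) +i* sin (x + (pi *+ 2) *~ n).
  by rewrite /expi -En addrC subrK.
have P (f : K -> K) : periodic f (pi *+ 2) -> f (x + (pi *+ 2) *~ n) = f x.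
  move=> pf; case: n {En} => n; first exact: periodicn.
  by rewrite NegzE mulrNz -[in RHS](subrK ((pi *+ 2) *+ n.+1) x) periodicn.
by rewrite (P cos (@cosD2pi K)) (P sin (@sinD2pi K)).
Qed.

Lemma expiN (K : realType) (a : angle K) : expi (- a) = (expi a)^*.
Proof.
rewrite -[a]reprK; set x := repr a.
have -> : - (\pi_(angle K) x) = \pi_(angle K) (- x) by rewrite piE.
by rewrite !expi_pi cosN sinN.
Qed.

(* Disjointness of vertices and edges is automatic, as they inhabit different
   types. Since every E_v is finite, a graph with finitely many vertices has
   finitely many edges. *)
Record fgraph := FGraph {
  vertex : finType;
  edge : finType;
  src : edge -> vertex;
  tgt : edge -> vertex;
  ebar : edge -> edge;
  ebarK : involutive ebar;
  ebar_neq : forall e, ebar e != e;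
  src_ebar : forall e, src (ebar e) = tgt e;
  tgt_ebar : forall e, tgt (ebar e) = src e }.

(* All vertex and edge weights are 1, so they are not recorded; A is the
   subgroup in which the magnetic potential takes its values. *)
Record mwgraph (K : realType) (A : zmodClosed (angle K)) := MWGraph {
  graph :> fgraph;
  potential : edge graph -> angle K;
  potential_in : forall e, potential e \in A;
  potential_ebar : forall e, potential (ebar e) = - potential e }.

Section DeleteEdges.
Variables (G : fgraph) (E0 : {set edge G}).
Hypothesis E0bar : {in E0, forall e, ebar e \in E0}.

Definition kept_edge : finType := {e : edge G | e \notin E0}.

Fact kept_ebar_subproof (e : kept_edge) : ebar (val e) \notin E0.
Proof. by apply: contra (valP e) => /E0bar; rewrite ebarK. Qed.

Definition kept_ebar (e : kept_edge) : kept_edge :=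
  exist _ (ebar (val e)) (kept_ebar_subproof e).

Fact kept_ebarK : involutive kept_ebar.
Proof. by move=> e; apply: val_inj; rewrite /= ebarK. Qed.

Fact kept_ebar_neq e : kept_ebar e != e.
Proof. by rewrite -val_eqE /= ebar_neq. Qed.

Definition delete_edges_fgraph : fgraph :=
  @FGraph (vertex G) kept_edge (fun e => src (val e)) (fun e => tgt (val e))
    kept_ebar kept_ebarK kept_ebar_neq
    (fun e => src_ebar (val e)) (fun e => tgt_ebar (val e)).

End DeleteEdges.

Definition delete_edges (K : realType) (A : zmodClosed (angle K))
    (G : mwgraph A) (E0 : {set edge G})
    (E0bar : {in E0, forall e, ebar e \in E0}) : mwgraph A :=
  @MWGraph K A (delete_edges_fgraph E0bar)
    (fun e : kept_edge E0 => potential (val e))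
    (fun e => potential_in (val e)) (fun e => potential_ebar (val e)).

Section Laplacian.
Variables (K : realType) (A : zmodClosed (angle K)) (G : mwgraph A).

Local Notation V := (vertex G).
Local Notation ell2 := {ffun V -> K[i]^o}.

Definition laplacian (phi : ell2) : ell2 :=
  [ffun v => \sum_(e : edge G | src e == v)
               (phi v - expi (potential e) * phi (tgt e))].

Fact laplacian_is_linear : linear laplacian.
Proof.
move=> a f g; apply/ffunP => v; rewrite !ffunE scaler_sumr -big_split /=.
apply: eq_bigr => e _; rewrite !ffunE !mulrDr.
rewrite scalerBr opprD addrACA; congr (_ - _ + _).
by rewrite /GRing.scale /= mulrCA.
Qed.

HB.instance Definition _ :=
  GRing.isLinear.Build K[i] ell2 ell2 *:%R laplacian laplacian_is_linear.

Definition delta (v : V) : ell2 := [ffun w => (w == v)%:R].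

Definition laplacian_mx : 'M[K[i]]_#|V| :=
  \matrix_(i, j) laplacian (delta (enum_val j)) (enum_val i).

Lemma laplacian_mxE (phi : ell2) (i : 'I_#|V|) :
  laplacian phi (enum_val i) = \sum_j laplacian_mx i j * phi (enum_val j).
Proof.
have {1}-> : phi = \sum_(j < #|V|) phi (enum_val j) *: delta (enum_val j).
  apply/ffunP => v; rewrite sum_ffunE (bigD1 (enum_rank v)) //= big1.
    by rewrite !ffunE enum_rankK eqxx addr0 /GRing.scale /= mulr1.
  move=> j jv; rewrite !ffunE; case: eqP => [vj|_]; last exact: scaler0.
  by rewrite vj enum_valK eqxx in jv.
rewrite linear_sum sum_ffunE; apply: eq_bigr => j _.
by rewrite linearZ !mxE ffunE mulrC.
Qed.

Lemma laplacian_mx_hermitian : laplacian_mx \is hermsymmx.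
Proof.
apply/is_hermitianmxP; rewrite expr0 scale1r; apply/matrixP => i j.
rewrite !mxE !ffunE !sumrB rmorphB /=; congr (_ - _).
  rewrite rmorph_sum /=.
  have [->|ij] := eqVneq i j.
    by apply: eq_bigr => e _; rewrite rmorph_nat.
  rewrite !big1 // => e _; rewrite (inj_eq enum_val_inj) ?(negbTE ij) //.
  by rewrite eq_sym (negbTE ij) rmorph0.
rewrite rmorph_sum /=.
transitivity (\sum_(e : edge G | (src e == enum_val i) && (tgt e == enum_val j))
                expi (potential e)).
  rewrite big_mkcondr; apply: eq_bigr => e _; rewrite ffunE.
  by case: (_ == _); rewrite ?mulr1 ?mulr0.
transitivity (\sum_(e : edge G | (src e == enum_val j) && (tgt e == enum_val i))
                (expi (potential e))^*); last first.
  rewrite big_mkcondr; apply: eq_bigr => e _; rewrite ffunE.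
  by case: (_ == _); rewrite ?mulr1 ?mulr0 ?rmorph0.
rewrite (reindex_inj (can_inj (@ebarK G))) /=.
apply: eq_big => [e|e _]; first by rewrite src_ebar tgt_ebar andbC.
by rewrite potential_ebar expiN.
Qed.

(* The roots of the characteristic polynomial, with multiplicity, sorted in
   nondecreasing order. They are real because the matrix is Hermitian, so
   taking real parts is harmless, see char_poly_laplacian_mx. *)
Definition eigenvalues : seq K :=
  sort <=%R [seq complex.Re z
            | z <- sval (closed_field_poly_normal (char_poly laplacian_mx))].

Definition lambda (k : nat) : K := eigenvalues`_k.-1.

Lemma char_poly_laplacian_mx :
  char_poly laplacian_mx = \prod_(a <- eigenvalues) ('X - (a%:C)%:P).
Proof.
rewrite /eigenvalues; case: closed_field_poly_normal => r /= Er.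
rewrite (perm_big _ (permEl (perm_sort _ _))) big_map.
rewrite {1}Er (monicP (char_poly_monic _)) scale1r.
apply: eq_big_seq => z zr; congr ('X - _%:P).
apply/esym/RRe_real.
have Lh := laplacian_mx_hermitian.
have : root (char_poly laplacian_mx) z.
  by rewrite Er (monicP (char_poly_monic _)) scale1r root_prod_XsubC.
rewrite -eigenvalue_root_char => /eigenvalueP[v vL v0].
have /orthomx_spectralP LE := hermitian_normalmx Lh.
have Pu := spectral_unit laplacian_mx.
set P := spectralmx _ in LE Pu; set D := spectral_diag _ in LE.
pose w := v *m invmx P.
have wD : w *m diag_mx D = z *: w.
  by rewrite scalemxAl -vL [in RHS]LE !mulmxA mulmxK.
have [j wj] : exists j, w 0 j != 0.
  apply/rV0Pn; apply: contra v0 => /eqP w0.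
  by rewrite -[v](mulmxKV Pu) -/w w0 mul0mx.
have := congr1 (fun u : 'rV_ _ => u 0 j) wD.
rewrite /= mul_mx_diag mxE [RHS]mxE mulrC => /(mulIf wj) <-.
by have /mxOverP := hermitian_spectral_diag_real Lh; apply.
Qed.

Lemma size_eigenvalues : size eigenvalues = #|V|.
Proof.
apply: succn_inj; rewrite -(size_prod_XsubC _ (fun a : K => a%:C)).
by rewrite -char_poly_laplacian_mx size_char_poly.
Qed.

End Laplacian.

(* Main.v *)
Require Import Defs.
From mathcomp Require Import all_boot all_order all_algebra reals.
From mathcomp Require Import complex trigo ring.

(** Deleting edges can only decrease the quadratic form of the Laplacian.
    Pairing each edge with its reverse, and using that every phase has modulus
    one, turns twice that form at phi into the energy
      sum over all edges e of |phi(src e) - exp(i alpha_e) phi(tgt e)|^2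
    ([laplacian_energy]), a sum of nonnegative terms over the edges; the
    subgraph merely omits the terms of the deleted edges
    ([qform_delete_edges]).

    It remains to see that the ordered eigenvalues of Hermitian matrices are
    monotone in the quadratic form. The Courant-Fischer dimension count is
    phrased with counting functions instead of min-max: if M <= N as forms, then
    for each real t at most as many eigenvalues of N as of M, with multiplicity,
    lie in ]-oo, t] ([leq_card_spectral_le]). Otherwise, the span of the
    eigenvectors of N with eigenvalue <= t and the span of those of M with
    eigenvalue > t would have total dimension above n, hence meet in some v <> 0,
    and then v would satisfy N(v) <= t |v|^2 < M(v). Taking for t the k-th
    eigenvalue of N, at least k eigenvalues of M are <= t, so the k-th one is
    ([nth_le_of_count_le]). *)

Set Implicit Arguments.
Unset Strict Implicit.
Unset Printing Implicit Defensive.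
Import Order.TTheory GRing.Theory Num.Theory.
Local Open Scope ring_scope.
Local Open Scope sesquilinear_scope.

(** * Sorted sequences and counting functions *)

(** At least i+1 entries of t, hence of s, are bounded by the i-th entry of t;
    as s is sorted, its i-th entry is one of them. *)
Lemma nth_le_of_count_le (disp : Order.disp_t) (T : orderType disp) (x0 : T)
    (s t : seq T) (i : nat) :
  sorted <=%O s -> sorted <=%O t -> (i < size t)%N ->
  (forall x, (count (fun y => y <= x)%O t <= count (fun y => y <= x)%O s)%N) ->
  (nth x0 s i <= nth x0 t i)%O.
Proof.
move=> ss st it le_count; apply: nth_count_le => //.
apply: leq_trans (le_count _); rewrite ltnNge; apply/negP => le_i.
by have := nth_count_gt x0 st (introT andP (conj le_i it)); rewrite ltxx.
Qed.

(** * Monotonicity of the spectrum of Hermitian matrices *)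

(** Fewer homogeneous linear equations than unknowns have a nonzero solution.
    The equations come in two groups, selected columns of A and of B, so that
    an intersection of two subspaces can be described by equations without
    computing any rank. *)
Lemma exists_common_zero (F : fieldType) (n p q : nat)
    (A : 'M[F]_(n, p)) (B : 'M[F]_(n, q)) (S : {set 'I_p}) (T : {set 'I_q}) :
  (#|S| + #|T| < n)%N ->
  exists v : 'rV[F]_n, [/\ v != 0, forall i, i \in S -> (v *m A) 0 i = 0
                        & forall i, i \in T -> (v *m B) 0 i = 0].
Proof.
move=> card_lt.
pose f (i : 'I_#|S|) := enum_val i; pose g (i : 'I_#|T|) := enum_val i.
pose M := row_mx (colsub f A) (colsub g B).
have : kermx M != 0.
  rewrite kermx_eq0 -row_leq_rank -ltnNge.
  exact: leq_ltn_trans (rank_leq_col _) card_lt.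
case/rowV0Pn => v /sub_kermxP vM v0; exists v.
have [vA vB] : v *m colsub f A = 0 /\ v *m colsub g B = 0.
  by apply/eq_row_mx; rewrite -mul_mx_row vM row_mx0.
split=> // i iS.
  have := congr1 (fun u : 'rV_ _ => u 0 (enum_rank_in iS i)) vA.
  by rewrite mulmx_colsub !mxE /f enum_rankK_in.
have := congr1 (fun u : 'rV_ _ => u 0 (enum_rank_in iS i)) vB.
by rewrite mulmx_colsub !mxE /g enum_rankK_in.
Qed.

Section HermitianSpectrum.
Variables (C : numClosedFieldType) (n : nat).
Implicit Types (M N : 'M[C]_n) (v : 'rV[C]_n) (t : C).

Definition qform M v : C := (v *m M *m v^t*) 0 0.

Definition spectral_le M t : {set 'I_n} := [set i | spectral_diag M 0 i <= t].

(** The rows of [spectralmx M] form an orthonormal basis of left eigenvectors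
    of M, so these are the inner products of v with them. *)
Definition spectral_coords M v : 'rV[C]_n := v *m (spectralmx M)^t*.

Lemma qform_spectral M v : M \is hermsymmx ->
  qform M v = \sum_i spectral_diag M 0 i * `|spectral_coords M v 0 i| ^+ 2.
Proof.
move=> /hermitian_normalmx/orthomx_spectralP ME.
rewrite /qform {1}ME invmx_unitary ?spectral_unitarymx //.
rewrite !mulmxA -/(spectral_coords M v) -[_ *m spectralmx M *m _]mulmxA.
have -> : spectralmx M *m v^t* = (spectral_coords M v)^t*.
  by rewrite /spectral_coords trmx_mul map_mxM /= trmxCK.
rewrite mxE; apply: eq_bigr => i _.
by rewrite mul_mx_diag !mxE normCK mulrCA mulrA.
Qed.

Lemma sqnorm_spectral M v :
  \sum_i `|spectral_coords M v 0 i| ^+ 2 = \sum_i `|v 0 i| ^+ 2.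
Proof.
have sqnormE (u : 'rV[C]_n) : \sum_i `|u 0 i| ^+ 2 = (u *m u^t*) 0 0.
  by rewrite mxE; apply: eq_bigr => i _; rewrite !mxE normCK.
rewrite !sqnormE /spectral_coords trmx_mul map_mxM /= trmxCK mulmxA.
by rewrite mulmxKtV // spectral_unitarymx.
Qed.

Lemma qform_le M v t : M \is hermsymmx ->
    (forall i, spectral_coords M v 0 i != 0 -> spectral_diag M 0 i <= t) ->
  qform M v <= t * \sum_i `|v 0 i| ^+ 2.
Proof.
move=> hM le_t; rewrite qform_spectral // -(sqnorm_spectral M) mulr_sumr.
apply: ler_sum => i _.
have [->|/le_t led] := eqVneq (spectral_coords M v 0 i) 0.
  by rewrite normr0 expr0n !mulr0.
by rewrite ler_wpM2r // exprn_ge0.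
Qed.

Lemma qform_gt M v t : M \is hermsymmx -> v != 0 ->
    (forall i, spectral_coords M v 0 i != 0 -> t < spectral_diag M 0 i) ->
  t * \sum_i `|v 0 i| ^+ 2 < qform M v.
Proof.
move=> hM v0 gt_t; rewrite qform_spectral // -(sqnorm_spectral M) mulr_sumr.
set w := spectral_coords M v in gt_t *.
have [j wj] : exists j, w 0 j != 0.
  apply/rV0Pn; apply: contra v0 => /eqP w0.
  rewrite -[v](mulmxKtV v (spectral_unitarymx M) erefl).
  by rewrite -/(spectral_coords M v) -/w w0 mul0mx.
have le_term i : t * `|w 0 i| ^+ 2 <= spectral_diag M 0 i * `|w 0 i| ^+ 2.
  have [->|/gt_t/ltW led] := eqVneq (w 0 i) 0.
    by rewrite normr0 expr0n !mulr0.
  by rewrite ler_wpM2r // exprn_ge0.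
rewrite (bigD1 j) // [ltRHS](bigD1 j) //=; apply: ltr_leD; last exact: ler_sum.
by rewrite ltr_pM2r ?gt_t // exprn_gt0 // normr_gt0.
Qed.

(** The dimension count: were the inequality to fail, the vectors with no
    component along the eigenvectors of N of eigenvalue > t, nor along those of
    M of eigenvalue <= t, would be cut out by fewer than n equations. A nonzero
    one contradicts the comparison of the two forms. *)
Lemma leq_card_spectral_le M N t : M \is hermsymmx -> N \is hermsymmx ->
    t \is Num.real -> (forall v, qform M v <= qform N v) ->
  (#|spectral_le N t| <= #|spectral_le M t|)%N.
Proof.
move=> hM hN tR le_q; set S := spectral_le N t; set T := spectral_le M t.
(* C is only partially ordered, so negating an inequality needs real sides. *)
have realD L i : L \is hermsymmx -> spectral_diag L 0 i \is Num.real.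
  by move=> /hermitian_spectral_diag_real/mxOverP; apply.
rewrite leqNgt; apply/negP => lt_TS.
have [] := @exists_common_zero _ n n n
             ((spectralmx N)^t* ) ((spectralmx M)^t* ) (~: S) T.
  by rewrite -[ltnRHS](card_ord n) -(cardsC S) addnC ltn_add2r.
move=> v [v0 vS vT].
have : t * \sum_i `|v 0 i| ^+ 2 < qform M v.
  apply: qform_gt => // i; apply: contra_neqT => le_it.
  by apply: vT; rewrite inE real_leNgt // realD.
apply/negP; rewrite -real_leNgt.
- apply: le_trans (le_q v) _; apply: qform_le => // i.
  by apply: contra_neqT => le_it; apply: vS; rewrite !inE.
- rewrite qform_spectral //; apply: sum_real => i _.
  by rewrite realM ?realD // rpredX // normr_real.
- by rewrite realM // sum_real // => i _; rewrite rpredX // normr_real.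
Qed.

Lemma char_poly_spectral M : M \is hermsymmx ->
  char_poly M = \prod_i ('X - (spectral_diag M 0 i)%:P).
Proof.
move=> /hermitian_normalmx/orthomx_spectralP ME.
have Pu := spectral_unit M.
rewrite {1}ME /char_poly /char_poly_mx !map_mxM map_invmx /=.
set D := diag_mx _; set P := map_mx polyC _.
have PU : P \in unitmx by rewrite map_unitmx.
have -> : 'X%:M - invmx P *m map_mx polyC D *m P
          = invmx P *m ('X%:M - map_mx polyC D) *m P.
  rewrite mulmxBr mulmxBl; congr (_ - _).
  by rewrite -scalemx1 -scalemxAr mulmx1 -scalemxAl mulVmx.
rewrite !det_mulmx mulrAC -det_mulmx mulVmx // det1 mul1r.
have := @char_poly_trig _ _ D (diag_mx_is_trig _).
by rewrite /char_poly => ->; apply: eq_bigr => i _; rewrite mxE eqxx.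
Qed.

End HermitianSpectrum.

(** * The energy of the magnetic Laplacian *)

(** The joint contribution of an edge with phase u, running from a vertex of
    value a to one of value b, and of its reverse, whose phase is u^*. *)
Lemma edge_energy (C : numClosedFieldType) (u a b : C) : u * u^* = 1 ->
  a^* * (a - u * b) + b^* * (b - u^* * a) = `|a - u * b| ^+ 2.
Proof.
move=> uu; rewrite normCK rmorphB rmorphM /=.
transitivity (a * a^* - u * a^* * b - u^* * b^* * a + 1 * (b * b^*)).
  by ring.
by rewrite -uu; ring.
Qed.

Lemma expi_conjM (K : realType) (a : angle K) : expi a * (expi a)^* = 1.
Proof.
apply/eqP; rewrite eq_complex /= mulrN opprK -!expr2 cos2Dsin2 eqxx /=.
by rewrite mulrN mulrC addrC subrr.
Qed.

Section LaplacianEnergy.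
Variables (K : realType) (A : zmodClosed (angle K)) (G : mwgraph A).
Local Notation V := (vertex G).

(** The factor 2 is there because an edge and its reverse have the same energy,
    and the sum ranges over both. *)
Lemma laplacian_energy (phi : {ffun V -> K[i]^o}) :
  (\sum_v (phi v)^* * laplacian phi v) *+ 2 =
  \sum_(e : edge G) `|phi (src e) - expi (potential e) * phi (tgt e)| ^+ 2.
Proof.
pose h (e : edge G) : K[i] :=
  (phi (src e))^* * (phi (src e) - expi (potential e) * phi (tgt e)).
have -> : \sum_v (phi v)^* * laplacian phi v = \sum_e h e.
  rewrite [RHS](partition_big (@src G) predT) //=; apply: eq_bigr => v _.
  by rewrite ffunE mulr_sumr; apply: eq_bigr => e /eqP <-.
rewrite mulr2n {2}(reindex_inj (can_inj (@ebarK G))) -big_split /=.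
apply: eq_bigr => e _; rewrite /h src_ebar tgt_ebar potential_ebar expiN.
exact/edge_energy/expi_conjM.
Qed.

(** [qform] uses row vectors whereas the Laplacian acts on columns: the
    function on vertices attached to v is its entrywise conjugate. *)
Lemma qform_laplacian_energy (v : 'rV[K[i]]_#|V|) :
  qform (laplacian_mx G) v *+ 2 =
  \sum_(e : edge G) `|(v 0 (enum_rank (src e)))^* -
     expi (potential e) * (v 0 (enum_rank (tgt e)))^*| ^+ 2.
Proof.
pose phi : {ffun V -> K[i]^o} := [ffun x => (v 0 (enum_rank x))^*].
transitivity ((\sum_x (phi x)^* * laplacian phi x) *+ 2); last first.
  by rewrite laplacian_energy; apply: eq_bigr => e _; rewrite !ffunE.
congr (_ *+ 2); rewrite /qform -mulmxA mxE.
rewrite [RHS](reindex _ (onW_bij _ (@enum_val_bij V))) /=.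
apply: eq_bigr => i _; rewrite laplacian_mxE ffunE enum_valK conjCK.
congr (_ * _); rewrite mxE; apply: eq_bigr => j _.
by rewrite ffunE !mxE enum_valK.
Qed.

(** The eigenvalues and the spectral diagonal are the roots of the same
    characteristic polynomial, hence agree up to order. *)
Lemma count_eigenvalues_le (t : K) :
  count (fun a => a <= t) (eigenvalues G) =
    #|spectral_le (laplacian_mx G) t%:C%C|.
Proof.
have perm_ev : perm_eq [seq a%:C%C | a <- eigenvalues G]
    [seq spectral_diag (laplacian_mx G) 0 i | i <- index_enum 'I_#|V|].
  apply: prod_XsubC_eq; rewrite !big_map -char_poly_laplacian_mx.
  exact/char_poly_spectral/laplacian_mx_hermitian.
transitivity (count (fun z => z <= t%:C%C) [seq a%:C%C | a <- eigenvalues G]).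
  by rewrite count_map; apply: eq_count => a /=; rewrite lecR.
by rewrite (permP perm_ev) count_map cardsE -sum1_card -sum1_count.
Qed.

End LaplacianEnergy.

(** * Deleting edges *)

Lemma qform_delete_edges (K : realType) (A : zmodClosed (angle K))
    (G : mwgraph A) (E0 : {set edge G})
    (E0bar : {in E0, forall e, ebar e \in E0}) (v : 'rV[K[i]]_#|vertex G|) :
  qform (laplacian_mx (delete_edges E0bar)) v <= qform (laplacian_mx G) v.
Proof.
rewrite -(ler_pMn2r (ltn0Sn 1)) !qform_laplacian_energy /=.
rewrite [leRHS](bigID (mem E0)) /= [X in _ + X]big_sub /=.
by rewrite lerDr; apply: sumr_ge0 => e _; rewrite exprn_ge0.
Qed.

Theorem corollary5p1 (K : realType) (A : zmodClosed (angle K)) (G : mwgraph A)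
    (E0 : {set edge G}) (E0bar : {in E0, forall e, ebar e \in E0}) (k : nat)
    (k_range : (1 <= k <= #|vertex G|)%N) :
  lambda (delete_edges E0bar) k <= lambda G k.
Proof.
case/andP: k_range => k_gt0 k_le.
have hL' := laplacian_mx_hermitian (delete_edges E0bar).
have hL := laplacian_mx_hermitian G.
(* The two graphs share their vertex type only up to conversion, so the common
   size of the two matrices is given explicitly. *)
have le_card (t : K) := @leq_card_spectral_le _ #|vertex G|
  (laplacian_mx (delete_edges E0bar)) (laplacian_mx G) t%:C%C hL' hL.
have le_count (t : K) : (count (fun a => (a <= t)%R) (eigenvalues G)
    <= count (fun a => (a <= t)%R) (eigenvalues (delete_edges E0bar)))%N.
  rewrite [leqLHS]count_eigenvalues_le [leqRHS]count_eigenvalues_le.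
  apply: le_card; first by rewrite complex_real.
  exact: qform_delete_edges.
apply: (nth_le_of_count_le 0 _ _ _ le_count).
- exact: sort_le_sorted.
- exact: sort_le_sorted.
- by rewrite size_eigenvalues prednK.
Qed.
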